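(* In virtual equipment type theory (VETT), let $\mathbb C$ be a small category, $R:\mathrm{Prof}\,\mathbb C\,\mathbb C$, and let $t:\forall\alpha{:}\mathbb C.\,R(\alpha;\alpha)$ be a natural element. Then in the transformation context $\alpha_1:\mathbb C,\;f:\alpha_1\to_{\mathbb C}\alpha_2,\;\alpha_2:\mathbb C$, the two elements $\mathrm{lcomp}(f,t^{\alpha_2})$ and $\mathrm{rcomp}(t^{\alpha_1},f)$ of $R(\alpha_1;\alpha_2)$, obtained by composing $t$ with the profunctorial action of $R$, are both equal to $\mathrm{ind}_\to(\alpha.\,t^\alpha,\alpha_1,f,\alpha_2)$.
   Context: **Judgments of VETT.** All judgments are relative to a context $\Gamma$ (suppressed below) of an extensional Martin-Löf dependent type theory. (i) Categories $\mathbb C$ Cat, some of which are small. (ii) Objects (functors) $\alpha:\mathbb C\vdash a:\mathbb D$, with exactly one free variable; variable rule $\alpha:\mathbb C\vdash\alpha:\mathbb C$. (iii) Sets (profunctors) $\Xi\vdash R$ Set, where a set context $\Xi$ is either $\alpha:\mathbb C$ or $\alpha:\mathbb C;\beta:\mathbb D$ (first variable contravariant, second covariant). In the first case $d^-\Xi=d^+\Xi=(\alpha:\mathbb C)$; in the second $d^-\Xi=(\alpha:\mathbb C)$, $d^+\Xi=(\beta:\mathbb D)$. (iv) Elements (natural transformations) $\Phi\vdash s:R$. A transformation context is $\Phi=\alpha_1:\mathbb C_1,x_1:R_1,\alpha_2:\mathbb C_2,\dots,x_n:R_n,\alpha_{n+1}:\mathbb C_{n+1}$ ($n\ge0$), each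 $R_i$ a set in context $\alpha_i:\mathbb C_i;\alpha_{i+1}:\mathbb C_{i+1}$. Put $d^-\Phi=\alpha_1:\mathbb C_1$, $d^+\Phi=\alpha_{n+1}:\mathbb C_{n+1}$, and $\underline\Phi=(\alpha_1:\mathbb C_1)$ if $n=0$, $\underline\Phi=d^-\Phi;d^+\Phi$ otherwise; $R$ must be a set in context $\underline\Phi$. Variable rule: $\alpha:\mathbb C,x:R,\beta:\mathbb D\vdash x:R$ (ordered, linear). If $d^+\Phi=d^-\Psi$, $\Phi\Join\Psi$ is concatenation sharing the common variable. **Substitution (admissible).** Objects substitute for object variables in objects; $R[a/\alpha;b/\beta]$ is a set in $\Xi$ when $R$ is a set in $\alpha:\mathbb C;\beta:\mathbb D$, $d^-\Xi\vdash a:\mathbb C$, $d^+\Xi\vdash b:\mathbb D$. A transformation substitution $\Psi\vdash\phi::\Phi$ is $\phi=a_1/\alpha_1,s_1/x_1,a_2/\alpha_2,\dots,s_n/x_n,a_{n+1}/\alpha_{n+1}$ with $\Psi=\Psi_1\Join\dots\Join\Psi_n$, $d^-\Psi_i\vdash a_i:\mathbb C_i$, $d^+\Psi_i\vdash a_{i+1}:\mathbb C_{i+1}$, $\Psi_i\vdash s_i:R_i[a_i/\alpha_i;a_{i+1}/\alpha_{i+1}]$ (for $n=0$: $\Psi=\beta:\mathbb D$ and $\beta:\mathbb D\vdash a_1:\mathbb C_1$); it sends $\Phi\vdash s:R$ to $\Psi\vdash s[\phi]:R[a_1/\alpha_1;a_{n+1}/\alpha_{n+1}]$. Equality is the congruence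 generated by the $\beta\eta$ rules (extensional style). **Connectives used here** (VETT has further connectives not needed for this statement). - $\mathrm{Prof}\,\mathbb C\,\mathbb D$ is the meta-language type of profunctors: terms are $\lambda\alpha;\beta.R$ for sets $R$ in $\alpha:\mathbb C;\beta:\mathbb D$, with application $M(a;b)$ (a set in $\Xi$ when $d^-\Xi\vdash a:\mathbb C$, $d^+\Xi\vdash b:\mathbb D$) and $\beta\eta$. For a set $P$ in context $\alpha:\mathbb C$, $\forall\alpha{:}\mathbb C.P$ is the type of natural elements: terms are $\lambda\alpha.t$ for elements $\alpha:\mathbb C\vdash t:P$, and $\beta:\mathbb D\vdash M^a:P[a/\alpha]$ for $M:\forall\alpha.P$, $\beta:\mathbb D\vdash a:\mathbb C$, with $\beta\eta$. - Unit (morphism set): for $d^-\Xi\vdash a:\mathbb C$, $d^+\Xi\vdash b:\mathbb C$, a set $a\to_{\mathbb C}b$ in $\Xi$. Introduction $\beta:\mathbb D\vdash\mathrm{id}_a:a\to_{\mathbb C}a$ for $\beta:\mathbb D\vdash a:\mathbb C$. Elimination: from a set $P$ in $\alpha:\mathbb C;\beta:\mathbb C$, $\alpha:\mathbb C\vdash t:P[\alpha/\alpha;\alpha/\beta]$ and $\Phi\vdash s:a\to_{\mathbb C}b$, infer $\Phi\vdash\mathrm{ind}_\to(\alpha.t,a,s,b):P[a/\alpha;b/\beta]$. $\beta$: $\mathrm{ind}_\to(\alpha.t,a,\mathrm{id}_a,a)=t[a/\alpha]$. $\eta$: for $\alpha_1:\mathbb C,z:\alpha_1\to_{\mathbb C}\alpha_2,\alpha_2:\mathbb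 C\vdash s:R$, $s=\mathrm{ind}_\to(\alpha.s[\alpha/\alpha_1,\mathrm{id}_\alpha/z,\alpha/\alpha_2],\alpha_1,z,\alpha_2)$. - Right hom: if the category of $d^+\Xi$ is small, $R$ a set in $d^+\Xi;\alpha:\mathbb C$, $P$ a set in $d^-\Xi;\alpha:\mathbb C$, a set $R\triangleright^{\forall\alpha:\mathbb C}P$ in $\Xi$. From $\Phi,x:R,\alpha:\mathbb C\vdash t:P$ infer $\Phi\vdash\lambda^\triangleright(x,\alpha).t:R\triangleright^{\forall\alpha}P$; from $\Phi_f\vdash s:R\triangleright^{\forall\alpha}P$, $d^+\Phi_a\vdash a:\mathbb C$, $\Phi_a\vdash t:R[a/\alpha]$ infer $\Phi_f\Join\Phi_a\vdash s\triangleright^at:P[a/\alpha]$; $\beta$: $(\lambda^\triangleright(x,\alpha).s)\triangleright^at=s[t/x,a/\alpha]$; $\eta$: $s=\lambda^\triangleright(x,\alpha).(s\triangleright^\alpha x)$. - Left hom: if the category of $d^-\Xi$ is small, $R$ a set in $\alpha:\mathbb C;d^-\Xi$, $P$ a set in $\alpha:\mathbb C;d^+\Xi$, a set $P\,{}^{\forall\alpha:\mathbb C}\!\triangleleft R$ in $\Xi$. From $\alpha:\mathbb C,x:R,\Phi\vdash t:P$ infer $\Phi\vdash\lambda^\triangleleft(\alpha,x).t:P\,{}^{\forall\alpha}\!\triangleleft R$; from $d^-\Phi_a\vdash a:\mathbb C$, $\Phi_a\vdash s:R[a/\alpha]$, $\Phi_f\vdash t:P\,{}^{\forall\alpha}\!\triangleleft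 R$ infer $\Phi_a\Join\Phi_f\vdash s\,{}^a\!\triangleleft t:P[a/\alpha]$; $\beta$: $s\,{}^a\!\triangleleft(\lambda^\triangleleft(\alpha,x).t)=t[a/\alpha,s/x]$; $\eta$: $t=\lambda^\triangleleft(\alpha,x).(x\,{}^\alpha\!\triangleleft t)$. **Profunctorial action and its one-sided versions.** For $\mathbb C$ small and $R:\mathrm{Prof}\,\mathbb C\,\mathbb C$, the term $$\mathrm{prof}(R)=\lambda\alpha_1.\lambda^\triangleright(f,\alpha_2).\,\mathrm{ind}_\to\big(\alpha.\,\lambda^\triangleright(r,\beta_1).\lambda^\triangleright(g,\beta_2).\;r\,{}^{\alpha}\!\triangleleft\,\mathrm{ind}_\to(\beta.\,\lambda^\triangleleft(\alpha,r).r,\;\beta_1,g,\beta_2),\;\alpha_1,f,\alpha_2\big)$$ has type $\forall\alpha_1.(\alpha_1\to_{\mathbb C}\alpha_2)\triangleright^{\forall\alpha_2}\big(R(\alpha_2;\beta_1)\triangleright^{\forall\beta_1}((\beta_1\to_{\mathbb C}\beta_2)\triangleright^{\forall\beta_2}R(\alpha_1;\beta_2))\big)$. Define - $\mathrm{lcomp}(f,r):=((\mathrm{prof}(R)^{\alpha_1}\triangleright^{\alpha_2}f)\triangleright^{\beta}r)\triangleright^{\beta}\mathrm{id}_\beta:R(\alpha_1;\beta)$ for $f:\alpha_1\to_{\mathbb C}\alpha_2$, $r:R(\alpha_2;\beta)$; - $\mathrm{rcomp}(r,g):=((\mathrm{prof}(R)^{\alpha}\triangleright^{\alpha}\mathrm{id}_\alpha)\triangleright^{\beta_1}r)\triangleright^{\beta_2}g:R(\alpha;\beta_2)$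 for $r:R(\alpha;\beta_1)$, $g:\beta_1\to_{\mathbb C}\beta_2$. In the claim, $t^{\alpha_2}$ (an element in context $\alpha_2:\mathbb C$) is substituted for $r$ in $\mathrm{lcomp}$ with $\beta:=\alpha_2$, and $t^{\alpha_1}$ for $r$ in $\mathrm{rcomp}$ with $\alpha=\beta_1:=\alpha_1$, $\beta_2:=\alpha_2$, $g:=f$. *)

(* Defs.v *)
From mathcomp Require Import all_boot.

Set Implicit Arguments.
Unset Strict Implicit.
Unset Printing Implicit Defensive.

(* A deep embedding of virtual equipment type theory (VETT) over an
   extensional Martin-Lof metalanguage with Pi, Sigma, unit, natural numbers
   and identity types, and with types of small categories, functors,
   profunctors and natural elements.

   Metalanguage variables are de Bruijn indices [mvar n].  The variables of
   VETT proper are nameless: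
   - an object has exactly one free variable, written [ovar];
   - a set in context Xi contains object variables only inside objects, and
     the position of such an object determines whether its variable is that
     of d^- Xi or that of d^+ Xi (or a variable bound by a hom);
   - elements are ordered linear: in Phi |- s : R the variables x_1, .., x_n
     of Phi occur in s exactly once each and in this order, so every
     occurrence is written [evar], and the k-th free occurrence from the left
     is x_k.

   Besides the categories named by terms of type [tCat], which are small,
   there is an arbitrary stock [K] of category constants, those satisfying
   [ksmall] being small. *)

Inductive mtm (K : Type) : Type :=
| mvar of nat
| mlam of mtm K
| mapp of mtm K & mtm K
| mpair of mtm K & mtm K
| mfst of mtm K
| msnd of mtm K
| mrefl
| mtt
| mzero
| msucc of mtm K
| mrec of mtm K & mtm K & mtm K        (* the step binds n, then the IH *)
| mquote of vcat K                      (* a small category as a term *)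
| mfun of ob K                         (* lambda alpha. a *)
| mprof of st K                        (* lambda alpha; beta. R *)
| mnat of el K                         (* lambda alpha. t *)
with vcat (K : Type) : Type :=
| cconst of K
| cEl of mtm K                         (* the category named by a term *)
with ob (K : Type) : Type :=
| ovar
| oapp of mtm K & ob K                 (* M(a) *)
with st (K : Type) : Type :=
| shom of vcat K & ob K & ob K          (* a ->_C b *)
| srhom of vcat K & st K & st K         (* srhom C R P : R |>^{forall C} P *)
| slhom of vcat K & st K & st K         (* slhom C P R : P ^{forall C}<| R *)
| sapp of mtm K & ob K & ob K          (* M(a;b) *)
with el (K : Type) : Type :=
| evar
| einst of mtm K & ob K                (* M^a *)
| eid of ob K
| eind of el K & ob K & el K & ob K    (* ind(alpha.t, a, s, b) *)
| elamr of el K                        (* lambda|>(x,alpha). t: binds the last x *)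
| eappr of el K & ob K & el K          (* eappr s a t : s |>^a t *)
| elaml of el K                        (* lambda<|(alpha,x). t: binds the first x *)
| eappl of el K & ob K & el K.         (* eappl s a t : s ^a<| t *)

Inductive mty (K : Type) : Type :=
| tPi of mty K & mty K
| tSigma of mty K & mty K
| tId of mty K & mtm K & mtm K
| tUnit
| tNat
| tCat                                 (* the type of small categories *)
| tFun of vcat K & vcat K
| tProf of vcat K & vcat K
| tAll of vcat K & st K.                (* forall alpha : C, P *)

Arguments tUnit {K}. Arguments tNat {K}. Arguments tCat {K}.
Arguments mvar {K} _. Arguments mrefl {K}. Arguments mtt {K}.
Arguments mzero {K}. Arguments ovar {K}. Arguments evar {K}.

(* Metalanguage substitution.  [v k n] is the image of the variable [n] under
   [k] metalanguage binders; VETT binders bind no metalanguage variable. *)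
Fixpoint map_tm K (v : nat -> nat -> mtm K) k (M : mtm K) : mtm K :=
  match M with
  | mvar n => v k n
  | mlam M => mlam (map_tm v k.+1 M)
  | mapp M N => mapp (map_tm v k M) (map_tm v k N)
  | mpair M N => mpair (map_tm v k M) (map_tm v k N)
  | mfst M => mfst (map_tm v k M)
  | msnd M => msnd (map_tm v k M)
  | mrefl => mrefl
  | mtt => mtt
  | mzero => mzero
  | msucc M => msucc (map_tm v k M)
  | mrec M0 M1 N => mrec (map_tm v k M0) (map_tm v k.+2 M1) (map_tm v k N)
  | mquote C => mquote (map_cat v k C)
  | mfun a => mfun (map_ob v k a)
  | mprof R => mprof (map_st v k R)
  | mnat s => mnat (map_el v k s)
  end
with map_cat K (v : nat -> nat -> mtm K) k (C : vcat K) : vcat K :=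
  match C with
  | cconst c => cconst c
  | cEl M => cEl (map_tm v k M)
  end
with map_ob K (v : nat -> nat -> mtm K) k (a : ob K) : ob K :=
  match a with
  | ovar => ovar
  | oapp M a => oapp (map_tm v k M) (map_ob v k a)
  end
with map_st K (v : nat -> nat -> mtm K) k (R : st K) : st K :=
  match R with
  | shom C a b => shom (map_cat v k C) (map_ob v k a) (map_ob v k b)
  | srhom C R P => srhom (map_cat v k C) (map_st v k R) (map_st v k P)
  | slhom C P R => slhom (map_cat v k C) (map_st v k P) (map_st v k R)
  | sapp M a b => sapp (map_tm v k M) (map_ob v k a) (map_ob v k b)
  end
with map_el K (v : nat -> nat -> mtm K) k (s : el K) : el K :=
  match s with
  | evar => evar
  | einst M a => einst (map_tm v k M) (map_ob v k a)
  | eid a => eid (map_ob v k a)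
  | eind t a s b =>
      eind (map_el v k t) (map_ob v k a) (map_el v k s) (map_ob v k b)
  | elamr t => elamr (map_el v k t)
  | eappr s a t => eappr (map_el v k s) (map_ob v k a) (map_el v k t)
  | elaml t => elaml (map_el v k t)
  | eappl s a t => eappl (map_el v k s) (map_ob v k a) (map_el v k t)
  end.

Fixpoint map_ty K (v : nat -> nat -> mtm K) k (A : mty K) : mty K :=
  match A with
  | tPi A B => tPi (map_ty v k A) (map_ty v k.+1 B)
  | tSigma A B => tSigma (map_ty v k A) (map_ty v k.+1 B)
  | tId A M N => tId (map_ty v k A) (map_tm v k M) (map_tm v k N)
  | tUnit => tUnit
  | tNat => tNat
  | tCat => tCat
  | tFun C D => tFun (map_cat v k C) (map_cat v k D)
  | tProf C D => tProf (map_cat v k C) (map_cat v k D)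
  | tAll C P => tAll (map_cat v k C) (map_st v k P)
  end.

Definition shift K (k n : nat) : mtm K :=
  if n < k then mvar n else mvar n.+1.
Definition lift_ty K c (A : mty K) := map_ty (@shift K) c A.
Definition lift_tm K c (M : mtm K) := map_tm (@shift K) c M.

Definition single K (N : mtm K) (k n : nat) : mtm K :=
  if n < k then mvar n
  else if n == k then iter k (lift_tm 0) N
  else mvar n.-1.
Definition inst_ty K (A : mty K) (N : mtm K) := map_ty (single N) 0 A.
Definition inst_tm K (M N : mtm K) := map_tm (single N) 0 M.

Inductive lookup (K : Type) : seq (mty K) -> nat -> mty K -> Prop :=
| lookup_here G A : lookup (A :: G) 0 (lift_ty 0 A)
| lookup_there G A B n :
    lookup G n A -> lookup (B :: G) n.+1 (lift_ty 0 A).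

Inductive sctx (K : Type) : Type :=
| X1 of vcat K
| X2 of vcat K & vcat K.

Definition xm K (X : sctx K) := match X with X1 C => C | X2 C _ => C end.
Definition xp K (X : sctx K) := match X with X1 C => C | X2 _ D => D end.

(* Transformation contexts: [tcons C R F] is  alpha : C, x : R, F. *)
Inductive tctx (K : Type) : Type :=
| tnil of vcat K
| tcons of vcat K & st K & tctx K.

Definition dm K (F : tctx K) := match F with tnil C => C | tcons C _ _ => C end.
Fixpoint dp K (F : tctx K) :=
  match F with tnil C => C | tcons _ _ F => dp F end.
Definition under K (F : tctx K) : sctx K :=
  match F with tnil C => X1 C | tcons C _ F => X2 C (dp F) end.

(* Meaningful only when [dp F = dm F']. *)
Fixpoint tjoin K (F F' : tctx K) : tctx K :=
  match F with tnil _ => F' | tcons C R F => tcons C R (tjoin F F') end.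

(* F, x : R, alpha : D. *)
Fixpoint tsnoc K (F : tctx K) (R : st K) (D : vcat K) : tctx K :=
  match F with
  | tnil C => tcons C R (tnil D)
  | tcons C R' F => tcons C R' (tsnoc F R D)
  end.

(* Transformation substitutions: [scons a s f] is  a/alpha, s/x, f. *)
Inductive tsub (K : Type) : Type :=
| snil of ob K
| scons of ob K & el K & tsub K.

Definition shead K (f : tsub K) := match f with snil a => a | scons a _ _ => a end.
Fixpoint slast K (f : tsub K) :=
  match f with snil a => a | scons _ _ f => slast f end.
Fixpoint ssnoc K (f : tsub K) (s : el K) (a : ob K) : tsub K :=
  match f with
  | snil b => scons b s (snil a)
  | scons b t f => scons b t (ssnoc f s a)
  end.
(* The parts of a substitution for the first n element variables and for the
   remaining ones; they share the n-th object. *)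
Fixpoint stake K n (f : tsub K) : tsub K :=
  match n, f with
  | n'.+1, scons a s f => scons a s (stake n' f)
  | _, _ => snil (shead f)
  end.
Fixpoint sdrop K n (f : tsub K) : tsub K :=
  match n, f with
  | n'.+1, scons _ _ f => sdrop n' f
  | _, _ => f
  end.
Fixpoint sid K (F : tctx K) : tsub K :=
  match F with tnil _ => snil ovar | tcons _ _ F => scons ovar evar (sid F) end.

Fixpoint osub K (a b : ob K) : ob K :=
  match a with ovar => b | oapp M a => oapp M (osub a b) end.

(* R[a/alpha; b/beta].  In R |> P, the set R lives over d^+ Xi; alpha and P
   over d^- Xi; alpha; dually for P <| R. *)
Fixpoint ssub K (R : st K) (a b : ob K) : st K :=
  match R with
  | shom C c d => shom C (osub c a) (osub d b)
  | srhom C R P => srhom C (ssub R b ovar) (ssub P a ovar)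
  | slhom C P R => slhom C (ssub P ovar b) (ssub R ovar a)
  | sapp M c d => sapp M (osub c a) (osub d b)
  end.

Fixpoint nvars K (s : el K) : nat :=
  match s with
  | evar => 1
  | einst _ _ | eid _ => 0
  | eind _ _ s _ => nvars s
  | elamr t | elaml t => (nvars t).-1
  | eappr s _ t | eappl s _ t => nvars s + nvars t
  end.

(* s[f].  In ind(alpha.t, a, s, b) the term t has no free variable besides
   the bound alpha. *)
Fixpoint esub K (s : el K) (f : tsub K) : el K :=
  match s with
  | evar => if f is scons _ t _ then t else evar
  | einst M a => einst M (osub a (shead f))
  | eid a => eid (osub a (shead f))
  | eind t a s b => eind t (osub a (shead f)) (esub s f) (osub b (slast f))
  | elamr t => elamr (esub t (ssnoc f evar ovar))
  | eappr s a t =>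
      eappr (esub s (stake (nvars s) f)) (osub a (slast f))
            (esub t (sdrop (nvars s) f))
  | elaml t => elaml (esub t (scons ovar evar f))
  | eappl s a t =>
      eappl (esub s (stake (nvars s) f)) (osub a (shead f))
            (esub t (sdrop (nvars s) f))
  end.

(* The judgments, all relative to a metalanguage context G. *)
Inductive jctx (K : Type) (ksmall : K -> Prop) | : seq (mty K) -> Prop :=
| ctx_nil : jctx [::]
| ctx_cons G A : jctx G -> jty G A -> jctx (A :: G)

(* G |- A type *)
with jty (K : Type) (ksmall : K -> Prop) | : seq (mty K) -> mty K -> Prop :=
| ty_Pi G A B : jty G A -> jty (A :: G) B -> jty G (tPi A B)
| ty_Sigma G A B : jty G A -> jty (A :: G) B -> jty G (tSigma A B)
| ty_Id G A M N : jty G A -> jtm G M A -> jtm G N A -> jty G (tId A M N)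
| ty_Unit G : jctx G -> jty G tUnit
| ty_Nat G : jctx G -> jty G tNat
| ty_Cat G : jctx G -> jty G tCat
| ty_Fun G C D : jcat G C -> jcat G D -> jty G (tFun C D)
| ty_Prof G C D : jcat G C -> jcat G D -> jty G (tProf C D)
| ty_All G C P : jst G (X1 C) P -> jty G (tAll C P)

(* G |- A = B type *)
with jtyeq (K : Type) (ksmall : K -> Prop) | :
  seq (mty K) -> mty K -> mty K -> Prop :=
| tyeq_refl G A : jty G A -> jtyeq G A A
| tyeq_sym G A B : jtyeq G A B -> jtyeq G B A
| tyeq_trans G A B C : jtyeq G A B -> jtyeq G B C -> jtyeq G A C
| tyeq_Pi G A A' B B' :
    jty G A -> jtyeq G A A' -> jtyeq (A :: G) B B' ->
    jtyeq G (tPi A B) (tPi A' B')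
| tyeq_Sigma G A A' B B' :
    jty G A -> jtyeq G A A' -> jtyeq (A :: G) B B' ->
    jtyeq G (tSigma A B) (tSigma A' B')
| tyeq_Id G A A' M M' N N' :
    jtyeq G A A' -> jtmeq G M M' A -> jtmeq G N N' A ->
    jtyeq G (tId A M N) (tId A' M' N')
| tyeq_Fun G C C' D D' :
    jcateq G C C' -> jcateq G D D' -> jtyeq G (tFun C D) (tFun C' D')
| tyeq_Prof G C C' D D' :
    jcateq G C C' -> jcateq G D D' -> jtyeq G (tProf C D) (tProf C' D')
| tyeq_All G C C' P P' :
    jcateq G C C' -> jsteq G (X1 C) P P' -> jtyeq G (tAll C P) (tAll C' P')

(* G |- M : A *)
with jtm (K : Type) (ksmall : K -> Prop) | :
  seq (mty K) -> mtm K -> mty K -> Prop :=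
| tm_conv G M A B : jtm G M A -> jtyeq G A B -> jtm G M B
| tm_var G n A : jctx G -> lookup G n A -> jtm G (mvar n) A
| tm_lam G A B M : jty G A -> jtm (A :: G) M B -> jtm G (mlam M) (tPi A B)
| tm_app G A B M N :
    jtm G M (tPi A B) -> jtm G N A -> jtm G (mapp M N) (inst_ty B N)
| tm_pair G A B M N :
    jty G A -> jty (A :: G) B -> jtm G M A -> jtm G N (inst_ty B M) ->
    jtm G (mpair M N) (tSigma A B)
| tm_fst G A B M : jtm G M (tSigma A B) -> jtm G (mfst M) A
| tm_snd G A B M :
    jtm G M (tSigma A B) -> jtm G (msnd M) (inst_ty B (mfst M))
| tm_refl G A M : jtm G M A -> jtm G mrefl (tId A M M)
| tm_tt G : jctx G -> jtm G mtt tUnit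
| tm_zero G : jctx G -> jtm G mzero tNat
| tm_succ G M : jtm G M tNat -> jtm G (msucc M) tNat
| tm_rec G A M0 M1 N :
    jty (tNat :: G) A -> jtm G M0 (inst_ty A mzero) ->
    jtm [:: A, tNat & G] M1
      (inst_ty (lift_ty 1 (lift_ty 1 A)) (msucc (mvar 1))) ->
    jtm G N tNat -> jtm G (mrec M0 M1 N) (inst_ty A N)
| tm_quote G C : jsmall G C -> jtm G (mquote C) tCat
| tm_fun G C D a : job G C a D -> jtm G (mfun a) (tFun C D)
| tm_prof G C D R : jst G (X2 C D) R -> jtm G (mprof R) (tProf C D)
| tm_nat G C P t : jel G (tnil C) t P -> jtm G (mnat t) (tAll C P)

(* G |- M = N : A *)
with jtmeq (K : Type) (ksmall : K -> Prop) | :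
  seq (mty K) -> mtm K -> mtm K -> mty K -> Prop :=
| tmeq_refl G M A : jtm G M A -> jtmeq G M M A
| tmeq_sym G M N A : jtmeq G M N A -> jtmeq G N M A
| tmeq_trans G M N P A : jtmeq G M N A -> jtmeq G N P A -> jtmeq G M P A
| tmeq_conv G M N A B : jtmeq G M N A -> jtyeq G A B -> jtmeq G M N B
| tmeq_lam G A B M M' :
    jty G A -> jtmeq (A :: G) M M' B -> jtmeq G (mlam M) (mlam M') (tPi A B)
| tmeq_app G A B M M' N N' :
    jtmeq G M M' (tPi A B) -> jtmeq G N N' A ->
    jtmeq G (mapp M N) (mapp M' N') (inst_ty B N)
| tmeq_pair G A B M M' N N' :
    jty G A -> jty (A :: G) B ->
    jtmeq G M M' A -> jtmeq G N N' (inst_ty B M) ->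
    jtmeq G (mpair M N) (mpair M' N') (tSigma A B)
| tmeq_fst G A B M M' :
    jtmeq G M M' (tSigma A B) -> jtmeq G (mfst M) (mfst M') A
| tmeq_snd G A B M M' :
    jtmeq G M M' (tSigma A B) ->
    jtmeq G (msnd M) (msnd M') (inst_ty B (mfst M))
| tmeq_succ G M M' : jtmeq G M M' tNat -> jtmeq G (msucc M) (msucc M') tNat
| tmeq_rec G A M0 M0' M1 M1' N N' :
    jty (tNat :: G) A -> jtmeq G M0 M0' (inst_ty A mzero) ->
    jtmeq [:: A, tNat & G] M1 M1'
      (inst_ty (lift_ty 1 (lift_ty 1 A)) (msucc (mvar 1))) ->
    jtmeq G N N' tNat ->
    jtmeq G (mrec M0 M1 N) (mrec M0' M1' N') (inst_ty A N)
| tmeq_quote G C C' :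
    jsmall G C -> jcateq G C C' -> jtmeq G (mquote C) (mquote C') tCat
| tmeq_fun G C D a a' :
    jobeq G C a a' D -> jtmeq G (mfun a) (mfun a') (tFun C D)
| tmeq_prof G C D R R' :
    jsteq G (X2 C D) R R' -> jtmeq G (mprof R) (mprof R') (tProf C D)
| tmeq_nat G C P t t' :
    jeleq G (tnil C) t t' P -> jtmeq G (mnat t) (mnat t') (tAll C P)
| tmeq_Pi_beta G A B M N :
    jtm (A :: G) M B -> jtm G N A ->
    jtmeq G (mapp (mlam M) N) (inst_tm M N) (inst_ty B N)
| tmeq_Pi_eta G A B M :
    jtm G M (tPi A B) ->
    jtmeq G M (mlam (mapp (lift_tm 0 M) (mvar 0))) (tPi A B)
| tmeq_fst_beta G A B M N :
    jty (A :: G) B -> jtm G M A -> jtm G N (inst_ty B M) ->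
    jtmeq G (mfst (mpair M N)) M A
| tmeq_snd_beta G A B M N :
    jty (A :: G) B -> jtm G M A -> jtm G N (inst_ty B M) ->
    jtmeq G (msnd (mpair M N)) N (inst_ty B M)
| tmeq_Sigma_eta G A B M :
    jtm G M (tSigma A B) ->
    jtmeq G M (mpair (mfst M) (msnd M)) (tSigma A B)
| tmeq_Unit_eta G M : jtm G M tUnit -> jtmeq G M mtt tUnit
| tmeq_Id_reflection G A M N P :
    jtm G P (tId A M N) -> jtmeq G M N A
| tmeq_Id_eta G A M N P :
    jtm G P (tId A M N) -> jtmeq G P mrefl (tId A M N)
| tmeq_rec_zero G A M0 M1 :
    jty (tNat :: G) A -> jtm G M0 (inst_ty A mzero) ->
    jtm [:: A, tNat & G] M1
      (inst_ty (lift_ty 1 (lift_ty 1 A)) (msucc (mvar 1))) ->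
    jtmeq G (mrec M0 M1 mzero) M0 (inst_ty A mzero)
| tmeq_rec_succ G A M0 M1 N :
    jty (tNat :: G) A -> jtm G M0 (inst_ty A mzero) ->
    jtm [:: A, tNat & G] M1
      (inst_ty (lift_ty 1 (lift_ty 1 A)) (msucc (mvar 1))) ->
    jtm G N tNat ->
    jtmeq G (mrec M0 M1 (msucc N))
      (inst_tm (inst_tm M1 (lift_tm 0 (mrec M0 M1 N))) N)
      (inst_ty A (msucc N))
| tmeq_Cat_eta G M : jtm G M tCat -> jtmeq G M (mquote (cEl M)) tCat
| tmeq_Fun_eta G C D M :
    jtm G M (tFun C D) -> jtmeq G M (mfun (oapp M ovar)) (tFun C D)
| tmeq_Prof_eta G C D M :
    jtm G M (tProf C D) -> jtmeq G M (mprof (sapp M ovar ovar)) (tProf C D)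
| tmeq_All_eta G C P M :
    jtm G M (tAll C P) -> jtmeq G M (mnat (einst M ovar)) (tAll C P)

(* G |- C Cat *)
with jcat (K : Type) (ksmall : K -> Prop) | : seq (mty K) -> vcat K -> Prop :=
| cat_const G c : jctx G -> jcat G (cconst c)
| cat_El G M : jtm G M tCat -> jcat G (cEl M)

(* G |- C Cat, and C is small *)
with jsmall (K : Type) (ksmall : K -> Prop) | : seq (mty K) -> vcat K -> Prop :=
| small_const G c : jctx G -> ksmall c -> jsmall G (cconst c)
| small_El G M : jtm G M tCat -> jsmall G (cEl M)
| small_conv G C D : jsmall G C -> jcateq G C D -> jcat G D -> jsmall G D

(* G |- C = D Cat *)
with jcateq (K : Type) (ksmall : K -> Prop) | :
  seq (mty K) -> vcat K -> vcat K -> Prop :=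
| cateq_refl G C : jcat G C -> jcateq G C C
| cateq_sym G C D : jcateq G C D -> jcateq G D C
| cateq_trans G C D E : jcateq G C D -> jcateq G D E -> jcateq G C E
| cateq_El G M N : jtmeq G M N tCat -> jcateq G (cEl M) (cEl N)
| cateq_El_beta G C : jsmall G C -> jcateq G (cEl (mquote C)) C

(* G | alpha : C |- a : D *)
with job (K : Type) (ksmall : K -> Prop) | :
  seq (mty K) -> vcat K -> ob K -> vcat K -> Prop :=
| ob_conv G C C' a D D' :
    job G C a D -> jcateq G C C' -> jcateq G D D' -> job G C' a D'
| ob_var G C : jcat G C -> job G C ovar C
| ob_app G B C D M a :
    jtm G M (tFun C D) -> job G B a C -> job G B (oapp M a) D

(* G | alpha : C |- a = b : D *)
with jobeq (K : Type) (ksmall : K -> Prop) | :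
  seq (mty K) -> vcat K -> ob K -> ob K -> vcat K -> Prop :=
| obeq_refl G C a D : job G C a D -> jobeq G C a a D
| obeq_sym G C a b D : jobeq G C a b D -> jobeq G C b a D
| obeq_trans G C a b c D :
    jobeq G C a b D -> jobeq G C b c D -> jobeq G C a c D
| obeq_conv G C C' a b D D' :
    jobeq G C a b D -> jcateq G C C' -> jcateq G D D' -> jobeq G C' a b D'
| obeq_app G B C D M N a b :
    jtmeq G M N (tFun C D) -> jobeq G B a b C ->
    jobeq G B (oapp M a) (oapp N b) D
| obeq_Fun_beta G B C D a b :
    job G C a D -> job G B b C -> jobeq G B (oapp (mfun a) b) (osub a b) D

(* G | X |- R Set *)
with jst (K : Type) (ksmall : K -> Prop) | :
  seq (mty K) -> sctx K -> st K -> Prop :=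
| st_conv1 G C C' R : jst G (X1 C) R -> jcateq G C C' -> jst G (X1 C') R
| st_conv2 G C C' D D' R :
    jst G (X2 C D) R -> jcateq G C C' -> jcateq G D D' -> jst G (X2 C' D') R
| st_hom G X C a b :
    job G (xm X) a C -> job G (xp X) b C -> jst G X (shom C a b)
| st_rhom G X C R P :
    jsmall G (xp X) -> jst G (X2 (xp X) C) R -> jst G (X2 (xm X) C) P ->
    jst G X (srhom C R P)
| st_lhom G X C R P :
    jsmall G (xm X) -> jst G (X2 C (xm X)) R -> jst G (X2 C (xp X)) P ->
    jst G X (slhom C P R)
| st_app G X C D M a b :
    jtm G M (tProf C D) -> job G (xm X) a C -> job G (xp X) b D ->
    jst G X (sapp M a b)

(* G | X |- R = S Set *)
with jsteq (K : Type) (ksmall : K -> Prop) | :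
  seq (mty K) -> sctx K -> st K -> st K -> Prop :=
| steq_refl G X R : jst G X R -> jsteq G X R R
| steq_sym G X R S : jsteq G X R S -> jsteq G X S R
| steq_trans G X R S T : jsteq G X R S -> jsteq G X S T -> jsteq G X R T
| steq_conv1 G C C' R S :
    jsteq G (X1 C) R S -> jcateq G C C' -> jsteq G (X1 C') R S
| steq_conv2 G C C' D D' R S :
    jsteq G (X2 C D) R S -> jcateq G C C' -> jcateq G D D' ->
    jsteq G (X2 C' D') R S
| steq_hom G X C C' a a' b b' :
    jcateq G C C' -> jobeq G (xm X) a a' C -> jobeq G (xp X) b b' C ->
    jsteq G X (shom C a b) (shom C' a' b')
| steq_rhom G X C C' R R' P P' :
    jsmall G (xp X) -> jcateq G C C' ->
    jsteq G (X2 (xp X) C) R R' -> jsteq G (X2 (xm X) C) P P' ->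
    jsteq G X (srhom C R P) (srhom C' R' P')
| steq_lhom G X C C' R R' P P' :
    jsmall G (xm X) -> jcateq G C C' ->
    jsteq G (X2 C (xm X)) R R' -> jsteq G (X2 C (xp X)) P P' ->
    jsteq G X (slhom C P R) (slhom C' P' R')
| steq_app G X C D M M' a a' b b' :
    jtmeq G M M' (tProf C D) ->
    jobeq G (xm X) a a' C -> jobeq G (xp X) b b' D ->
    jsteq G X (sapp M a b) (sapp M' a' b')
| steq_Prof_beta G X C D R a b :
    jst G (X2 C D) R -> job G (xm X) a C -> job G (xp X) b D ->
    jsteq G X (sapp (mprof R) a b) (ssub R a b)

(* G |- F = F', transformation contexts *)
with jtceq (K : Type) (ksmall : K -> Prop) | :
  seq (mty K) -> tctx K -> tctx K -> Prop :=
| tceq_nil G C C' : jcateq G C C' -> jtceq G (tnil C) (tnil C')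
| tceq_cons G C C' R R' F F' :
    jcateq G C C' -> jsteq G (X2 C (dm F)) R R' -> jtceq G F F' ->
    jtceq G (tcons C R F) (tcons C' R' F')

(* G | F |- s : R *)
with jel (K : Type) (ksmall : K -> Prop) | :
  seq (mty K) -> tctx K -> el K -> st K -> Prop :=
| el_conv G F F' s R R' :
    jel G F s R -> jtceq G F F' -> jsteq G (under F) R R' -> jel G F' s R'
| el_var G C D R : jst G (X2 C D) R -> jel G (tcons C R (tnil D)) evar R
| el_inst G C D M P a :
    jtm G M (tAll C P) -> job G D a C ->
    jel G (tnil D) (einst M a) (ssub P a a)
| el_hom_id G C D a : job G D a C -> jel G (tnil D) (eid a) (shom C a a)
| el_hom_ind G F C P t a s b :
    jst G (X2 C C) P -> jel G (tnil C) t (ssub P ovar ovar) ->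
    job G (dm F) a C -> job G (dp F) b C -> jel G F s (shom C a b) ->
    jel G F (eind t a s b) (ssub P a b)
| el_lamr G F C R P t :
    jst G (under F) (srhom C R P) -> jel G (tsnoc F R C) t P ->
    jel G F (elamr t) (srhom C R P)
| el_appr G F F' C R P s a t :
    dp F = dm F' -> jel G F s (srhom C R P) ->
    job G (dp F') a C -> jel G F' t (ssub R ovar a) ->
    jel G (tjoin F F') (eappr s a t) (ssub P ovar a)
| el_laml G F C R P t :
    jst G (under F) (slhom C P R) -> jel G (tcons C R F) t P ->
    jel G F (elaml t) (slhom C P R)
| el_appl G F F' C R P s a t :
    dp F' = dm F -> job G (dm F') a C -> jel G F' s (ssub R a ovar) ->
    jel G F t (slhom C P R) ->
    jel G (tjoin F' F) (eappl s a t) (ssub P a ovar)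

(* G | F |- s = t : R *)
with jeleq (K : Type) (ksmall : K -> Prop) | :
  seq (mty K) -> tctx K -> el K -> el K -> st K -> Prop :=
| eleq_refl G F s R : jel G F s R -> jeleq G F s s R
| eleq_sym G F s t R : jeleq G F s t R -> jeleq G F t s R
| eleq_trans G F s t u R :
    jeleq G F s t R -> jeleq G F t u R -> jeleq G F s u R
| eleq_conv G F F' s t R R' :
    jeleq G F s t R -> jtceq G F F' -> jsteq G (under F) R R' ->
    jeleq G F' s t R'
(* Typing under substitution is admissible up to the smallness conditions on
   homs, which substitution need not preserve; hence the typing premises. The
   rule extends [eleq_hom_eta] from the generic context to all instances. *)
| eleq_sub G F F' f s t R :
    jeleq G F s t R -> jsub G F' f F ->
    jel G F' (esub s f) (ssub R (shead f) (slast f)) ->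
    jel G F' (esub t f) (ssub R (shead f) (slast f)) ->
    jeleq G F' (esub s f) (esub t f) (ssub R (shead f) (slast f))
| eleq_inst G C D M M' P a a' :
    jtmeq G M M' (tAll C P) -> jobeq G D a a' C ->
    jeleq G (tnil D) (einst M a) (einst M' a') (ssub P a a)
| eleq_hom_id G C D a a' :
    jobeq G D a a' C -> jeleq G (tnil D) (eid a) (eid a') (shom C a a)
| eleq_hom_ind G F C P t t' a a' s s' b b' :
    jst G (X2 C C) P -> jeleq G (tnil C) t t' (ssub P ovar ovar) ->
    jobeq G (dm F) a a' C -> jobeq G (dp F) b b' C ->
    jeleq G F s s' (shom C a b) ->
    jeleq G F (eind t a s b) (eind t' a' s' b') (ssub P a b)
| eleq_lamr G F C R P t t' :
    jst G (under F) (srhom C R P) -> jeleq G (tsnoc F R C) t t' P ->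
    jeleq G F (elamr t) (elamr t') (srhom C R P)
| eleq_appr G F F' C R P s s' a a' t t' :
    dp F = dm F' -> jeleq G F s s' (srhom C R P) ->
    jobeq G (dp F') a a' C -> jeleq G F' t t' (ssub R ovar a) ->
    jeleq G (tjoin F F') (eappr s a t) (eappr s' a' t') (ssub P ovar a)
| eleq_laml G F C R P t t' :
    jst G (under F) (slhom C P R) -> jeleq G (tcons C R F) t t' P ->
    jeleq G F (elaml t) (elaml t') (slhom C P R)
| eleq_appl G F F' C R P s s' a a' t t' :
    dp F' = dm F -> jobeq G (dm F') a a' C ->
    jeleq G F' s s' (ssub R a ovar) -> jeleq G F t t' (slhom C P R) ->
    jeleq G (tjoin F' F) (eappl s a t) (eappl s' a' t') (ssub P a ovar)
| eleq_All_beta G C D P t a :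
    jel G (tnil C) t P -> job G D a C ->
    jeleq G (tnil D) (einst (mnat t) a) (esub t (snil a)) (ssub P a a)
| eleq_hom_beta G C D P t a :
    jst G (X2 C C) P -> jel G (tnil C) t (ssub P ovar ovar) -> job G D a C ->
    jeleq G (tnil D) (eind t a (eid a) a) (esub t (snil a)) (ssub P a a)
| eleq_hom_eta G C R s :
    jel G (tcons C (shom C ovar ovar) (tnil C)) s R ->
    jeleq G (tcons C (shom C ovar ovar) (tnil C)) s
      (eind (esub s (scons ovar (eid ovar) (snil ovar))) ovar evar ovar) R
| eleq_rhom_beta G F F' C R P s a t :
    dp F = dm F' -> jst G (under F) (srhom C R P) ->
    jel G (tsnoc F R C) s P ->
    job G (dp F') a C -> jel G F' t (ssub R ovar a) ->
    jeleq G (tjoin F F') (eappr (elamr s) a t) (esub s (ssnoc (sid F) t a))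
      (ssub P ovar a)
| eleq_rhom_eta G F C R P s :
    jel G F s (srhom C R P) ->
    jeleq G F s (elamr (eappr s ovar evar)) (srhom C R P)
| eleq_lhom_beta G F F' C R P s a t :
    dp F' = dm F -> jst G (under F) (slhom C P R) ->
    jel G (tcons C R F) t P ->
    job G (dm F') a C -> jel G F' s (ssub R a ovar) ->
    jeleq G (tjoin F' F) (eappl s a (elaml t)) (esub t (scons a s (sid F)))
      (ssub P a ovar)
| eleq_lhom_eta G F C R P t :
    jel G F t (slhom C P R) ->
    jeleq G F t (elaml (eappl evar ovar t)) (slhom C P R)

(* G | F' |- f :: F *)
with jsub (K : Type) (ksmall : K -> Prop) | :
  seq (mty K) -> tctx K -> tsub K -> tctx K -> Prop :=
| sub_nil G D a C : job G D a C -> jsub G (tnil D) (snil a) (tnil C)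
| sub_cons G F1 F2 C R F a s f :
    dp F1 = dm F2 -> jst G (X2 C (dm F)) R ->
    job G (dm F1) a C -> jel G F1 s (ssub R a (shead f)) -> jsub G F2 f F ->
    jsub G (tjoin F1 F2) (scons a s f) (tcons C R F).

(* The profunctorial action.  The lambdas carry no annotation, so the
   profunctor R enters only through the type, see [prof_typed]. *)
Definition prof K : mtm K :=
  mnat (elamr (eind
    (elamr (elamr (eappl evar ovar
       (eind (elaml evar) ovar evar ovar))))
    ovar evar ovar)).

Definition prof_type K (C : vcat K) (R : mtm K) : mty K :=
  tAll C (srhom C (shom C ovar ovar)
    (srhom C (sapp R ovar ovar)
      (srhom C (shom C ovar ovar) (sapp R ovar ovar)))).

Lemma small_cat K (ksmall : K -> Prop) G C : jsmall ksmall G C -> jcat ksmall G C.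
Proof. by case=> // *; constructor. Qed.

Lemma prof_typed K (ksmall : K -> Prop) G (C : vcat K) (R : mtm K) :
  jsmall ksmall G C -> jtm ksmall G R (tProf C C) ->
  jtm ksmall G (prof K) (prof_type C R).
Proof.
move=> sC tR; have o : job ksmall G C ovar C := ob_var (small_cat sC).
have hs X : xm X = C -> xp X = C -> jst ksmall G X (shom C ovar ovar).
  by move=> eM eP; apply: st_hom; rewrite ?eM ?eP.
have Rs X : xm X = C -> xp X = C -> jst ksmall G X (sapp R ovar ovar).
  by move=> eM eP; apply: st_app tR _ _; rewrite ?eM ?eP.
have rs X A B : xm X = C -> xp X = C -> jst ksmall G (X2 C C) A ->
    jst ksmall G (X2 C C) B -> jst ksmall G X (srhom C A B).
  by move=> eM eP sA sB; apply: st_rhom; rewrite ?eM ?eP.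
have ls X A B : xm X = C -> xp X = C -> jst ksmall G (X2 C C) A ->
    jst ksmall G (X2 C C) B -> jst ksmall G X (slhom C A B).
  by move=> eM eP sA sB; apply: st_lhom; rewrite ?eM ?eP.
set RR := sapp R ovar ovar in Rs *; set H := shom C ovar ovar in hs *.
rewrite /prof_type -/H -/RR; apply: tm_nat.
apply: el_lamr; first by repeat (apply rs || apply hs || apply Rs).
apply: (@el_hom_ind _ _ _ _ C (srhom C RR (srhom C H RR))) => //.
- by repeat (apply rs || apply hs || apply Rs).
- apply: el_lamr; first by repeat (apply rs || apply hs || apply Rs).
  apply: el_lamr; first by repeat (apply rs || apply hs || apply Rs).
  apply: (@el_appl _ _ _ (tcons C H (tnil C)) (tcons C RR (tnil C)) C RR RR) => //.
    by apply: el_var; apply: Rs.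
  apply: (@el_hom_ind _ _ _ _ C (slhom C RR RR)) => //.
  + by repeat (apply ls || apply Rs).
  + apply: el_laml; first by repeat (apply ls || apply Rs).
    by apply: el_var; apply: Rs.
  + by apply: el_var; apply: hs.
- by apply: el_var; apply: hs.
Qed.

(* lcomp(f,r) in context  alpha1, f, alpha2, r, beta. *)
Definition lcomp K : el K :=
  eappr (eappr (eappr (einst (prof K) ovar) ovar evar) ovar evar)
        ovar (eid ovar).

(* rcomp(r,g) in context  alpha, r, beta1, g, beta2. *)
Definition rcomp K : el K :=
  eappr (eappr (eappr (einst (prof K) ovar) ovar (eid ovar)) ovar evar)
        ovar evar.

(* Main.v *)
Require Import Defs.
From mathcomp Require Import all_boot.

(* Substituting id for f turns lcomp(f,t) and rcomp(t,f) into the same element,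
   the action of two identities on t, which beta-reduces to t; the eta rule of
   the morphism set then identifies both with ind(alpha.t, alpha1, f, alpha2). *)

Section Sets.
Context {K : Type} {ksmall : K -> Prop} {G : seq (mty K)} {C : vcat K}.
Context {X : sctx K} (sC : jsmall ksmall G C) (eM : xm X = C) (eP : xp X = C).

(** The two ends of [X] are fixed only by equations, so the lemmas of this section serve [X1 C],
    [X2 C C] and every [under F] whose ends compute to [C]. *)
Lemma st_hom_ovar : jst ksmall G X (shom C ovar ovar).
Proof. by apply: st_hom; rewrite ?eM ?eP; apply: ob_var; apply: small_cat sC. Qed.

Lemma st_app_ovar R :
  jtm ksmall G R (tProf C C) -> jst ksmall G X (sapp R ovar ovar).
Proof.
by move=> tR; apply: (st_app tR); rewrite ?eM ?eP; apply: ob_var;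
  apply: small_cat sC.
Qed.

Lemma st_rhom_small A B : jst ksmall G (X2 C C) A -> jst ksmall G (X2 C C) B ->
  jst ksmall G X (srhom C A B).
Proof. by move=> sA sB; apply: st_rhom; rewrite ?eM ?eP. Qed.

Lemma st_lhom_small A B : jst ksmall G (X2 C C) A -> jst ksmall G (X2 C C) B ->
  jst ksmall G X (slhom C A B).
Proof. by move=> sA sB; apply: st_lhom; rewrite ?eM ?eP. Qed.

End Sets.

Ltac set_typing :=
  repeat (apply: st_hom_ovar || apply: st_app_ovar ||
          apply: st_rhom_small || apply: st_lhom_small); simpl; done.

(** The eta rule of the morphism set asks for typed elements. Three independent contexts let both
    composites be instances: [f] carries the variable in [lcomp], [g] in [rcomp], and the other two
    contexts are trivial. *)
Lemma act_el (K : Type) (ksmall : K -> Prop) (G : seq (mty K)) (C : vcat K)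
    (R : mtm K) (F F' F'' : tctx K) (f r g : el K) :
  jsmall ksmall G C -> jtm ksmall G R (tProf C C) ->
  dm F = C -> dp F = C -> dm F' = C -> dp F' = C -> dm F'' = C -> dp F'' = C ->
  jel ksmall G F f (shom C ovar ovar) ->
  jel ksmall G F' r (sapp R ovar ovar) ->
  jel ksmall G F'' g (shom C ovar ovar) ->
  jel ksmall G (tjoin (tjoin F F') F'')
    (eappr (eappr (eappr (einst (prof K) ovar) ovar f) ovar r) ovar g)
    (sapp R ovar ovar).
Proof.
move=> sC tR mF pF mF' pF' mF'' pF'' tf tr tg.
have o : job ksmall G C ovar C := ob_var (small_cat sC).
set RR := sapp R ovar ovar in tr *; set H := shom C ovar ovar in tf tg *.
have dp_join : dp (tjoin F F') = C.
  by elim: F {mF pF tf}.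
apply: (@el_appr _ _ _ _ _ C H RR) => //; rewrite ?dp_join ?pF'' //.
apply: (@el_appr _ _ _ _ _ C RR (srhom C H RR)) => //; rewrite ?pF ?pF' //.
(* [prof] has no element variables, so it is typed in [tnil C], whose join with [F] computes to
   [F]. *)
apply: (@el_appr _ _ _ (tnil C) _ C H (srhom C RR (srhom C H RR)));
  rewrite ?pF //.
exact: el_inst (prof_typed sC tR) o.
Qed.

Lemma act_id_id (K : Type) (ksmall : K -> Prop) (G : seq (mty K)) (C : vcat K)
    (R t : mtm K) :
  jsmall ksmall G C -> jtm ksmall G R (tProf C C) ->
  jtm ksmall G t (tAll C (sapp R ovar ovar)) ->
  jeleq ksmall G (tnil C)
    (eappr (eappr (eappr (einst (prof K) ovar) ovar (eid ovar))
       ovar (einst t ovar)) ovar (eid ovar))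
    (einst t ovar) (sapp R ovar ovar).
Proof.
move=> sC tR tt.
have o : job ksmall G C ovar C := ob_var (small_cat sC).
have oo := obeq_refl o; have tid := el_hom_id o.
have tr : jel ksmall G (tnil C) (einst t ovar) (sapp R ovar ovar).
  exact: el_inst tt o.
set r := einst t ovar in tr *.
set RR := sapp R ovar ovar in tr *; set H := shom C ovar ovar in tid.
(* [V] is right composition with a morphism, as an element of the left hom from [RR] to itself; [T]
   is the branch of the outer induction in [prof]. *)
set V := eind (elaml evar) ovar evar ovar : el K.
set T := elamr (elamr (eappl evar ovar V)).
have tI : jel ksmall G (tnil C) (elaml evar) (slhom C RR RR).
  by apply: el_laml; [set_typing | apply: el_var; set_typing].
have tV : jel ksmall G (tcons C H (tnil C)) V (slhom C RR RR).
  apply: (@el_hom_ind _ _ _ _ C (slhom C RR RR)) => //; first by set_typing.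
  by apply: el_var; set_typing.
(* Needed both for the bound variable of type [RR] and, with [F] trivial, for [r]. *)
have tW F s : dp F = C -> dm F = C -> jel ksmall G F s RR ->
    jel ksmall G (tjoin F (tcons C H (tnil C))) (eappl s ovar V) RR.
  move=> eP eM ts; apply: (@el_appl _ _ _ _ F C RR RR) => //.
  by rewrite eM.
have tLW : jel ksmall G (tcons C RR (tnil C)) (elamr (eappl evar ovar V))
    (srhom C H RR).
  apply: el_lamr; first by set_typing.
  by apply: (tW (tcons C RR (tnil C))) => //; apply: el_var; set_typing.
have tT : jel ksmall G (tnil C) T (srhom C RR (srhom C H RR)).
  by apply: el_lamr => //; set_typing.
have step1 : jeleq ksmall G (tnil C)
    (eappr (einst (prof K) ovar) ovar (eid ovar)) T
    (srhom C RR (srhom C H RR)).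
  pose B := eind T ovar evar ovar.
  have tB : jel ksmall G (tcons C H (tnil C)) B (srhom C RR (srhom C H RR)).
    apply: (@el_hom_ind _ _ _ _ C (srhom C RR (srhom C H RR))) => //.
      by set_typing.
    by apply: el_var; set_typing.
  have tLB : jel ksmall G (tnil C) (elamr B)
      (srhom C H (srhom C RR (srhom C H RR))).
    by apply: el_lamr => //; set_typing.
  apply: (@eleq_trans _ _ _ _ _ (eappr (elamr B) ovar (eid ovar))).
    apply: (@eleq_appr _ _ _ (tnil C) (tnil C) C H
      (srhom C RR (srhom C H RR))) => //; last exact: eleq_refl.
    exact: eleq_All_beta tLB o.
  apply: (@eleq_trans _ _ _ _ _ (eind T ovar (eid ovar) ovar)).
    apply: (@eleq_rhom_beta _ _ _ (tnil C) (tnil C) C H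
      (srhom C RR (srhom C H RR)) B) => //.
    by set_typing.
  apply: (@eleq_hom_beta _ _ _ C C (srhom C RR (srhom C H RR))) => //.
  by set_typing.
have step2 : jeleq ksmall G (tnil C) (eappr T ovar r)
    (elamr (eappl r ovar V)) (srhom C H RR).
  apply: (@eleq_rhom_beta _ _ _ (tnil C) (tnil C) C RR (srhom C H RR)) => //.
  by set_typing.
(* As [nvars r] is 0, the identity is substituted into [V] and [r] stays fixed. *)
have step3 : jeleq ksmall G (tnil C)
    (eappr (elamr (eappl r ovar V)) ovar (eid ovar))
    (eappl r ovar (eind (elaml evar) ovar (eid ovar) ovar)) RR.
  apply: (@eleq_rhom_beta _ _ _ (tnil C) (tnil C) C H RR (eappl r ovar V)) => //.
    by set_typing.
  exact: (tW (tnil C)).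
(* At an identity, [V] reduces to the identity function [elaml evar]. *)
have step4 : jeleq ksmall G (tnil C)
    (eappl r ovar (eind (elaml evar) ovar (eid ovar) ovar)) r RR.
  apply: (@eleq_trans _ _ _ _ _ (eappl r ovar (elaml evar))).
    apply: (@eleq_appl _ _ _ (tnil C) (tnil C) C RR RR) => //.
      exact: eleq_refl.
    apply: (@eleq_hom_beta _ _ _ C C (slhom C RR RR)) => //.
    by set_typing.
  apply: (@eleq_lhom_beta _ _ _ (tnil C) (tnil C) C RR RR) => //.
    by set_typing.
  by apply: el_var; set_typing.
apply: eleq_trans step4; apply: eleq_trans step3.
apply: (@eleq_appr _ _ _ (tnil C) (tnil C) C H RR) => //; last exact: eleq_refl.
apply: eleq_trans step2.
apply: (@eleq_appr _ _ _ (tnil C) (tnil C) C RR (srhom C H RR)) => //.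
exact: eleq_refl.
Qed.

(* The two left-hand sides are lcomp(f,r)[f/f, t^{alpha2}/r, alpha2/beta] and
   rcomp(r,g)[alpha1/alpha, t^{alpha1}/r, alpha1/beta1, f/g, alpha2/beta2]. *)
Theorem lemma1 (K : Type) (ksmall : K -> Prop) (G : seq (mty K))
    (C : vcat K) (R t : mtm K) :
  jsmall ksmall G C ->
  jtm ksmall G R (tProf C C) ->
  jtm ksmall G t (tAll C (sapp R ovar ovar)) ->
  let F := tcons C (shom C ovar ovar) (tnil C) in
  let t_ind := eind (einst t ovar) ovar evar ovar in
  jeleq ksmall G F
    (esub (lcomp K) (scons ovar evar (scons ovar (einst t ovar) (snil ovar))))
    t_ind (sapp R ovar ovar)
  /\
  jeleq ksmall G F
    (esub (rcomp K) (scons ovar (einst t ovar) (scons ovar evar (snil ovar))))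
    t_ind (sapp R ovar ovar).
Proof.
move=> sC tR tt F t_ind.
have o : job ksmall G C ovar C := ob_var (small_cat sC).
have t_el : jel ksmall G (tnil C) (einst t ovar) (sapp R ovar ovar).
  exact: el_inst tt o.
have f_el : jel ksmall G F evar (shom C ovar ovar).
  by apply: el_var; set_typing.
have id_el : jel ksmall G (tnil C) (eid ovar) (shom C ovar ovar).
  exact: el_hom_id o.
(* Morphism induction: an element over [f] is determined by its value at the identity. *)
have by_ind s : jel ksmall G F s (sapp R ovar ovar) ->
    jeleq ksmall G (tnil C) (esub s (scons ovar (eid ovar) (snil ovar)))
      (einst t ovar) (sapp R ovar ovar) ->
    jeleq ksmall G F s t_ind (sapp R ovar ovar).
  move=> ts s_id; apply: eleq_trans (eleq_hom_eta ts) _.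
  apply: (@eleq_hom_ind _ _ _ _ C (sapp R ovar ovar)) => //;
    by [set_typing | apply: obeq_refl | apply: eleq_refl].
(* With the identity for the morphism variable, both composites compute to the left side of
   [act_id_id]; only their typings remain. *)
split; apply: by_ind; try exact: act_id_id sC tR tt.
- exact: (@act_el _ _ _ C _ F (tnil C) (tnil C)).
- exact: (@act_el _ _ _ C _ (tnil C) (tnil C) F).
Qed.
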